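(* Let $P=P_XP_{Y|X}$ and $Q=Q_XQ_{Y|X}$ be joint distributions on $\mathsf X\times\mathsf Y$, with Bayes decision rules $\psi_P,\psi_Q:\mathsf X\to\mathsf A$ with respect to $(\mathsf A,\ell)$ under $P$ and $Q$. Write $P_x=P_{Y|X=x}$ and $Q_x=Q_{Y|X=x}$. (i) If $B_Q\in\mathbb R$ satisfies both $$\mathbb E_P[\ell(Y,\psi_Q(X))]-\mathbb E_Q[\ell(Y,\psi_Q(X))]\le B_Q\quad\text{and}\quad\mathbb E_Q[\ell(Y,\psi_P(X))]-\mathbb E_P[\ell(Y,\psi_P(X))]\le B_Q$$ (so that in particular $|H_\ell(Q_{Y|X}|Q_X)-H_\ell(P_{Y|X}|P_X)|\le B_Q$), then $$\mathbb E_P[\ell(Y,\psi_Q(X))]-H_\ell(P_{Y|X}|P_X)\le2B_Q.$$ (ii) If $B_P\in\mathbb R$ satisfies both $$\int_{\mathsf X}\big(\mathbb E_{P_x}[\ell(Y,\psi_Q(x))]-\mathbb E_{Q_x}[\ell(Y,\psi_Q(x))]\big)P_X(\mathrm dx)\le B_P$$ and $$\int_{\mathsf X}\big(\mathbb E_{Q_x}[\ell(Y,\psi_P(x))]-\mathbb E_{P_x}[\ell(Y,\psi_P(x))]\big)P_X(\mathrm dx)\le B_P$$ (so that in particular $|H_\ell(Q_{Y|X}|P_X)-H_\ell(P_{Y|X}|P_X)|\le B_P$), then $$\mathbb E_P[\ell(Y,\psi_Q(X))]-H_\ell(P_{Y|X}|P_X)\le2B_P.$$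
   Context: $\mathsf A$ is an action space and $\ell:\mathsf Y\times\mathsf A\to\mathbb R$ a loss function. The generalized conditional entropy of a joint distribution $P_XP_{Y|X}$ is $H_\ell(P_{Y|X}|P_X)=\inf_{\psi:\mathsf X\to\mathsf A}\mathbb E_P[\ell(Y,\psi(X))]$, the infimum over all decision rules with well-defined expected loss; equivalently $\int_{\mathsf X}H_\ell(P_{Y|X=x})P_X(\mathrm dx)$ with $H_\ell(R)=\inf_{a\in\mathsf A}\mathbb E_R[\ell(Y,a)]$. $H_\ell(Q_{Y|X}|P_X)$ is the same quantity for the joint distribution $P_XQ_{Y|X}$. The Bayes decision rules are assumed to exist: $H_\ell(P_{Y|X}|P_X)=\mathbb E_P[\ell(Y,\psi_P(X))]$, $H_\ell(Q_{Y|X}|Q_X)=\mathbb E_Q[\ell(Y,\psi_Q(X))]$, and for each $x$, $\psi_P(x)$ and $\psi_Q(x)$ are actions attaining $H_\ell(P_{Y|X=x})$ and $H_\ell(Q_{Y|X=x})$. All expectations appearing are assumed well defined and finite. *)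

(* Defs.v *)
From HB Require Import structures.
From mathcomp Require Import all_boot all_order all_algebra.
From mathcomp Require Import all_classical all_reals all_analysis.

Set Implicit Arguments.
Unset Strict Implicit.
Unset Printing Implicit Defensive.
Import Order.TTheory GRing.Theory Num.Theory.
Import numFieldNormedType.Exports.

Local Open Scope classical_set_scope.
Local Open Scope ring_scope.
Local Open Scope ereal_scope.

(* The fibres of a probability kernel are only measures in the library's
   hierarchy; [cond_law K x] repackages [K x] as a probability, so that
   ['E_(cond_law K x)[ f ]] is the expectation of f given X = x. *)
Definition cond_law dX dY (X : measurableType dX) (Y : measurableType dY)
    (R : realType) (K : R.-pker X ~> Y) (x : X) : set Y -> \bar R := K x.

HB.instance Definition _ dX dY (X : measurableType dX) (Y : measurableType dY)
    (R : realType) (K : R.-pker X ~> Y) (x : X) :=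
  Measure.on (cond_law K x).

HB.instance Definition _ dX dY (X : measurableType dX) (Y : measurableType dY)
    (R : realType) (K : R.-pker X ~> Y) (x : X) :=
  Measure_isProbability.Build dY Y R (cond_law K x) (prob_kernel x).

(* The joint distribution P_X P_{Y|X}: the library's product of kernels, with
   P_X seen as a constant kernel from the one-point space and P_{Y|X} ignoring
   that point; see [joint_lawE] for the explicit formula. *)
Definition joint_law dX dY (X : measurableType dX) (Y : measurableType dY)
    (R : realType) (PX : probability X R) (K : R.-pker X ~> Y) :
    set (X * Y) -> \bar R :=
  mkproduct
    (kprobability (measurable_cst (PX : pprobability X R)
                   : measurable_fun [set: unit] _))
    (kernel.kernel_snd K) tt.

HB.instance Definition _ dX dY (X : measurableType dX) (Y : measurableType dY)
    (R : realType) (PX : probability X R) (K : R.-pker X ~> Y) :=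
  Measure.on (joint_law PX K).

Lemma joint_lawE dX dY (X : measurableType dX) (Y : measurableType dY)
    (R : realType) (PX : probability X R) (K : R.-pker X ~> Y)
    (A : set (X * Y)) :
  measurable A -> joint_law PX K A = \int[PX]_x K x (xsection A x).
Proof.
move=> mA; rewrite /joint_law /mkproduct /kproduct /=.
by apply: eq_integral => x _; rewrite kernel.intker_indicE.
Qed.

Lemma joint_law_setT dX dY (X : measurableType dX) (Y : measurableType dY)
    (R : realType) (PX : probability X R) (K : R.-pker X ~> Y) :
  joint_law PX K [set: X * Y] = 1.
Proof.
rewrite joint_lawE//.
under eq_integral => x _.
  have -> : xsection [set: X * Y] x = [set: Y].
    by apply/seteqP; split => // y _; rewrite /xsection/= inE.
  rewrite prob_kernel; over.
rewrite integral_cst// mul1e; exact: probability_setT.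
Qed.

HB.instance Definition _ dX dY (X : measurableType dX) (Y : measurableType dY)
    (R : realType) (PX : probability X R) (K : R.-pker X ~> Y) :=
  Measure_isProbability.Build _ _ R (joint_law PX K) (joint_law_setT PX K).

(* The expectation of f under P makes sense in [-oo, +oo]: f is measurable and
   its positive and negative parts do not both have infinite expectation.
   (Without this restriction the library's integral returns a junk value, which
   would pollute the infima below.) *)
Definition expectation_defined d (T : measurableType d) (R : realType)
    (P : probability T R) (f : T -> R) : Prop :=
  measurable_fun [set: T] f /\
  (\int[P]_t (EFin \o f)^\+ t < +oo \/ \int[P]_t (EFin \o f)^\- t < +oo).

Definition expectation_finite d (T : measurableType d) (R : realType)
    (P : probability T R) (f : T -> R) : Prop :=
  P.-integrable [set: T] (EFin \o f).

Definition rule_loss (X Y A : Type) (R : realType) (ell : Y -> A -> R)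
    (psi : X -> A) : X * Y -> R :=
  fun z => ell z.2 (psi z.1).

(* H_ell(M) = inf_a E_M[ell(Y, a)] *)
Definition gen_entropy dY (Y : measurableType dY) (A : Type) (R : realType)
    (ell : Y -> A -> R) (M : probability Y R) : \bar R :=
  ereal_inf [set 'E_M[ell^~ a] | a in
    [set a : A | expectation_defined M (ell^~ a)]].

(* H_ell(P_{Y|X} | P_X) = inf_psi E[ell(Y, psi(X))]. The action space carries no
   sigma-algebra: measurability is only required of the resulting loss. *)
Definition gen_cond_entropy dX dY (X : measurableType dX)
    (Y : measurableType dY) (A : Type) (R : realType) (ell : Y -> A -> R)
    (K : R.-pker X ~> Y) (PX : probability X R) : \bar R :=
  ereal_inf [set 'E_(joint_law PX K)[rule_loss ell psi] | psi in
    [set psi : X -> A | expectation_defined (joint_law PX K) (rule_loss ell psi)]].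

(* psi is a Bayes decision rule under P_X P_{Y|X}, with finite expected losses:
   optimal on average, and optimal at every x for the conditional law. *)
Definition is_bayes_rule dX dY (X : measurableType dX)
    (Y : measurableType dY) (A : Type) (R : realType) (ell : Y -> A -> R)
    (PX : probability X R) (K : R.-pker X ~> Y) (psi : X -> A) : Prop :=
  [/\ expectation_finite (joint_law PX K) (rule_loss ell psi),
      gen_cond_entropy ell K PX = 'E_(joint_law PX K)[rule_loss ell psi],
      (forall x, expectation_finite (cond_law K x) (ell^~ (psi x))) &
      (forall x, gen_entropy ell (cond_law K x)
                 = 'E_(cond_law K x)[ell^~ (psi x)])].

(* Main.v *)
(* In both parts the risk gap splits as
     a - d = (a - b) + (b - c) + (c - d) <= B + 0 + B,
   where a, d are the risks of psiQ, psiP under the target law, b, c their risks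
   under the other law, and b <= c because psiQ is a Bayes rule for the latter.
   Part (ii) applies this after disintegrating the risks along P_X, where b <= c
   comes from the fibrewise optimality of psiQ. Its entropy bound also needs
   H(Q_{Y|X} | P_X) to be the P_X-average of the fibrewise entropies: the lower
   bound on the risk of an arbitrary rule is obtained fibre by fibre. *)
Require Import Defs.
From mathcomp Require Import all_boot all_order all_algebra.
From mathcomp Require Import all_classical all_reals all_analysis.
From mathcomp Require Import measurable_realfun lra.

Set Implicit Arguments.
Unset Strict Implicit.
Unset Printing Implicit Defensive.
Import Order.TTheory GRing.Theory Num.Theory.
Import numFieldNormedType.Exports.

Local Open Scope classical_set_scope.
Local Open Scope ring_scope.
Local Open Scope ereal_scope.

(** * Disintegration of integrals against the joint law *)

Section joint_law_integral.
Context dX dY (X : measurableType dX) (Y : measurableType dY) (R : realType).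
Variables (PX : probability X R) (K : R.-pker X ~> Y).

Lemma measurable_fun_integral_fibre (f : X * Y -> \bar R) :
  (forall z, 0 <= f z) -> measurable_fun [set: X * Y] f ->
  measurable_fun [set: X] (fun x => \int[K x]_y f (x, y)).
Proof. by move=> f0 mf; exact: (measurable_fun_integral_finite_kernel f K). Qed.

Lemma integral_fibre_indic (E : set (X * Y)) x : measurable E ->
  \int[K x]_y (\1_E (x, y))%:E = K x (xsection E x).
Proof.
move=> mE; rewrite (_ : (fun y => _) = EFin \o \1_(xsection E x)).
  by rewrite integral_indic ?setIT//; exact: measurable_xsection.
by apply/funext => y; rewrite /= !indicE mem_xsection.
Qed.

Import HBNNSimple.

(** Base case of the disintegration: linearity over the finitely many values reduces it to
    indicators, where it is [joint_lawE]. *)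
Lemma integral_joint_law_nnsfun (f : {nnsfun (X * Y)%type >-> R}) :
  \int[joint_law PX K]_z (f z)%:E = \int[PX]_x \int[K x]_y (f (x, y))%:E.
Proof.
have mfr r : measurable (f @^-1` [set r]) by [].
have mfibre r : measurable_fun [set: X] (fun x =>
    \int[K x]_y (r * \1_(f @^-1` [set r]) (x, y))%:E).
  (* The side conditions of [ge0_integral_fsum] range over all reals [r], not only the values of
     [f]. A negative [r] has empty preimage, so its term vanishes. *)
  have [r0|r0] := leP 0%R r.
    pose g z := (r * \1_(f @^-1` [set r]) z)%:E.
    apply: (@measurable_fun_integral_fibre g) => [z|].
      by rewrite lee_fin mulr_ge0.
    by apply/measurable_EFinP; exact: measurable_funM.
  rewrite (_ : (fun x => _) = cst 0)//; apply/funext => x.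
  by apply: integral0_eq => y _; rewrite preimage_nnfun0// indic0 mulr0.
have fge0 r z : 0 <= (r * \1_(f @^-1` [set r]) z)%:E.
  by rewrite EFinM nnfun_muleindic_ge0.
under eq_integral do rewrite fimfunE -fsumEFin//.
rewrite ge0_integral_fsum//; last first.
  by move=> r; exact/measurable_EFinP/measurable_funM.
under [in RHS]eq_integral => x _.
  under eq_integral do rewrite fimfunE -fsumEFin//.
  rewrite ge0_integral_fsum//; last first.
    move=> r; apply/measurable_EFinP/measurableT_comp => //.
    exact: measurableT_comp.
  over.
rewrite /= ge0_integral_fsum//; last by move=> r x _; exact: integral_ge0.
apply: eq_fsbigr => r _.
have [r0|r0] := leP 0%R r; last first.
  rewrite [LHS]integral0_eq; last first.
    by move=> z _; rewrite preimage_nnfun0// indic0 mulr0.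
  rewrite integral0_eq// => x _; apply: integral0_eq => y _.
  by rewrite preimage_nnfun0// indic0 mulr0.
under [in LHS]eq_integral do rewrite EFinM.
rewrite ge0_integralZl//; last exact/measurable_EFinP.
rewrite integral_indic// setIT [X in _ * X]joint_lawE//.
rewrite -ge0_integralZl//; last first.
  by apply: measurable_fun_xsection_finite_kernel; rewrite inE.
apply: eq_integral => x _; rewrite -integral_fibre_indic//.
rewrite -ge0_integralZl//; apply/measurable_EFinP.
exact: measurableT_comp.
Qed.

(** Monotone convergence along simple approximations: once for the joint law, then for [PX] and for
    each fibre [K x]. *)
Lemma ge0_integral_joint_law (f : X * Y -> \bar R) :
  (forall z, 0 <= f z) -> measurable_fun [set: X * Y] f ->
  \int[joint_law PX K]_z f z = \int[PX]_x \int[K x]_y f (x, y).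
Proof.
move=> f0 mf; pose f_ := nnsfun_approx measurableT mf.
have f_cvg z : limn (fun n => (f_ n z)%:E) = f z.
  by apply/cvg_lim => //; exact: cvg_nnsfun_approx.
have ndf_ z : {homo (fun n => (f_ n z)%:E) : a b / (a <= b)%N >-> a <= b}.
  by move=> a b ab; rewrite lee_fin; exact/lefP/nd_nnsfun_approx.
have mf_ n : measurable_fun [set: X * Y] (fun z => (f_ n z)%:E).
  exact/measurable_EFinP.
have mf_x n x : measurable_fun [set: Y] (fun y => (f_ n (x, y))%:E).
  by apply/measurable_EFinP; exact: measurableT_comp.
under [in LHS]eq_integral do rewrite -f_cvg.
rewrite monotone_convergence//; last by move=> n z _; rewrite lee_fin.
under eq_fun do rewrite integral_joint_law_nnsfun.
rewrite -monotone_convergence//.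
- apply: eq_integral => x _; rewrite -monotone_convergence//.
  + by apply: eq_integral => y _; rewrite f_cvg.
  + by move=> n y _; rewrite lee_fin.
- move=> n; apply: (@measurable_fun_integral_fibre (EFin \o f_ n)).
    by move=> z; rewrite lee_fin.
  exact: mf_.
- by move=> n x _; apply: integral_ge0 => y _; rewrite lee_fin.
- move=> x _ a b ab; apply: ge0_le_integral => //.
  + by move=> y _; rewrite lee_fin.
  + by move=> y _; exact: ndf_.
Qed.

(** The parts are taken on the product before restricting to a fibre, so that measurability in [x]
    follows from the nonnegative case. *)
Lemma integral_fibreE (f : X * Y -> \bar R) x :
  \int[K x]_y f (x, y)
  = \int[K x]_y f^\+ (x, y) - \int[K x]_y f^\- (x, y).
Proof.
rewrite integralE -[fun y => f (x, y)]/(f \o pair x).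
by rewrite funepos_comp funeneg_comp.
Qed.

Lemma ge0_integrable_fibre (f : X * Y -> \bar R) :
  (forall z, 0 <= f z) -> measurable_fun [set: X * Y] f ->
  \int[joint_law PX K]_z f z < +oo ->
  PX.-integrable [set: X] (fun x => \int[K x]_y f (x, y)).
Proof.
move=> f0 mf foo; apply/integrableP; split.
  exact: measurable_fun_integral_fibre.
under eq_integral do rewrite gee0_abs ?integral_ge0//.
by rewrite -ge0_integral_joint_law.
Qed.

Section integrable.
Variable f : X * Y -> \bar R.
Hypothesis intf : (joint_law PX K).-integrable [set: X * Y] f.

Let mf : measurable_fun [set: X * Y] f. Proof. exact: measurable_int intf. Qed.

Let intp : PX.-integrable [set: X] (fun x => \int[K x]_y f^\+ (x, y)).
Proof.
apply: ge0_integrable_fibre => //; first exact: measurable_funepos.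
exact: integral_funepos_lt_pinfty.
Qed.

Let intn : PX.-integrable [set: X] (fun x => \int[K x]_y f^\- (x, y)).
Proof.
apply: ge0_integrable_fibre => //; first exact: measurable_funeneg.
exact: integral_funeneg_lt_pinfty.
Qed.

Lemma integrable_fibre :
  PX.-integrable [set: X] (fun x => \int[K x]_y f (x, y)).
Proof.
by under eq_fun do rewrite integral_fibreE; exact: integrableB.
Qed.

(** The fibre integrals of both parts are [PX]-integrable, so the integral of their difference
    splits and the nonnegative case applies to each. *)
Lemma integral_joint_law :
  \int[joint_law PX K]_z f z = \int[PX]_x \int[K x]_y f (x, y).
Proof.
under [RHS]eq_integral do rewrite integral_fibreE.
rewrite integralB// [LHS]integralE.
congr (_ - _); apply: ge0_integral_joint_law => //.
  exact: measurable_funepos.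
exact: measurable_funeneg.
Qed.

End integrable.

End joint_law_integral.

Lemma expectation_finite_defined d (T : measurableType d) (R : realType)
    (P : probability T R) (f : T -> R) :
  expectation_finite P f -> expectation_defined P f.
Proof.
move=> intf; split; first exact/measurable_EFinP/(measurable_int _ intf).
by left; exact: integral_funepos_lt_pinfty.
Qed.

Lemma expectation_finite_fin_num d (T : measurableType d) (R : realType)
    (P : probability T R) (f : T -> R) :
  expectation_finite P f -> 'E_P[f] \is a fin_num.
Proof. by move=> intf; rewrite unlock integrable_fin_num. Qed.

(** [maxe h 0] and [maxe (- h) 0] are the positive and negative parts of [h]. If [n] is +oo,
    finiteness of [p] forces [h] to be -oo, and the right side is +oo. *)
Lemma leeD_funeposneg (R : realType) (h p n : \bar R) :
  p < +oo -> 0 <= p -> 0 <= n ->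
  h <= p - n -> maxe h 0 + n <= p + maxe (- h) 0.
Proof.
move: h p n => [h| |] [p| |] [n| |]//=.
- rewrite -!EFin_max -!EFinD !lee_fin => _ _ _.
  by rewrite /Num.max/=; case: ifPn; case: ifPn; lra.
all: by move=> _ _ _ _; rewrite /maxe ltNyr /= ?add0e leey.
Qed.

(** * Entropies as lower bounds on risks *)

Section entropy.
Context dX dY (X : measurableType dX) (Y : measurableType dY) (R : realType).
Variables (A : Type) (ell : Y -> A -> R).
Variables (K : R.-pker X ~> Y) (PX : probability X R).

Lemma gen_entropy_le x a : expectation_finite (cond_law K x) (ell^~ a) ->
  gen_entropy ell (cond_law K x) <= 'E_(cond_law K x)[ell^~ a].
Proof.
move=> fin; apply: ereal_inf_lbound; exists a => //.
exact: expectation_finite_defined.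
Qed.

Lemma gen_cond_entropy_le psi :
  expectation_finite (joint_law PX K) (rule_loss ell psi) ->
  gen_cond_entropy ell K PX <= 'E_(joint_law PX K)[rule_loss ell psi].
Proof.
move=> fin; apply: ereal_inf_lbound; exists psi => //.
exact: expectation_finite_defined.
Qed.

Lemma expectation_rule_loss psi :
  expectation_finite (joint_law PX K) (rule_loss ell psi) ->
  'E_(joint_law PX K)[rule_loss ell psi]
  = \int[PX]_x 'E_(cond_law K x)[ell^~ (psi x)].
Proof. by move=> fin; rewrite unlock integral_joint_law. Qed.

Lemma integrable_expectation_rule_loss psi :
  expectation_finite (joint_law PX K) (rule_loss ell psi) ->
  PX.-integrable [set: X] (fun x => 'E_(cond_law K x)[ell^~ (psi x)]).
Proof.
by move=> fin; rewrite expectation.unlock; exact: (integrable_fibre fin).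
Qed.

Lemma le_gen_cond_entropy (h : X -> \bar R) :
  PX.-integrable [set: X] h ->
  (forall x, h x <= gen_entropy ell (cond_law K x)) ->
  \int[PX]_x h x <= gen_cond_entropy ell K PX.
Proof.
move=> inth hle; apply: le_ereal_inf_tmp => _ [psi [mpsi defpsi] <-].
rewrite unlock [leLHS]integralE [leRHS]integralE.
pose f := EFin \o rule_loss ell psi.
have mf : measurable_fun [set: X * Y] f by exact/measurable_EFinP.
have mfp : measurable_fun [set: X * Y] f^\+ by exact: measurable_funepos.
have mfn : measurable_fun [set: X * Y] f^\- by exact: measurable_funeneg.
have mh := measurable_int _ inth.
(* The bound h <= p - n between the fibrewise h and the fibrewise parts p, n of
   the loss, with every term moved so that all are nonnegative: it then holds
   even where p = n = +oo, and it can be integrated termwise. *)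
have fibre x : h^\+ x + \int[K x]_y f^\- (x, y)
    <= \int[K x]_y f^\+ (x, y) + h^\- x.
  have [poo|] := ltP (\int[K x]_y f^\+ (x, y)) +oo; last first.
    rewrite leye_eq => /eqP ->; rewrite addye ?leey//.
    by rewrite gt_eqF// (lt_le_trans _ (funeneg_ge0 h x)).
  rewrite funeposE funenegE; apply: leeD_funeposneg => //.
  - exact: integral_ge0.
  - exact: integral_ge0.
  - apply: (le_trans (hle x)); rewrite -integral_fibreE.
    (* The finite positive part on this fibre makes [psi x] admissible in the infimum defining
       [gen_entropy]. *)
    apply: ereal_inf_lbound; exists (psi x); last by rewrite unlock.
    split; first exact: (measurable_fun_pair2 x mpsi).
    by left; rewrite -[EFin \o _]/(f \o pair x) funepos_comp.
have : \int[PX]_x h^\+ x + \int[joint_law PX K]_z f^\- z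
    <= \int[joint_law PX K]_z f^\+ z + \int[PX]_x h^\- x.
  rewrite !ge0_integral_joint_law//.
  have mp := measurable_fun_integral_fibre K (funepos_ge0 f) mfp.
  have mn := measurable_fun_integral_fibre K (funeneg_ge0 f) mfn.
  rewrite -!ge0_integralD//; try by
    [exact: measurable_funepos | exact: measurable_funeneg
    | move=> x _; exact: integral_ge0].
  apply: ge0_le_integral => //.
  - by move=> x _; rewrite adde_ge0// integral_ge0.
  - by apply: emeasurable_funD => //; exact: measurable_funepos.
  - by apply: emeasurable_funD => //; exact: measurable_funeneg.
(* The parts of [h] have finite integrals and can be moved back across. [defpsi] excludes the case
   where both parts of the loss have infinite integral, which the inequality alone would allow. *)
have := integral_funepos_lt_pinfty measurableT inth.
have := integral_funeneg_lt_pinfty measurableT inth.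
have : 0 <= \int[PX]_x h^\+ x by exact: integral_ge0.
have : 0 <= \int[PX]_x h^\- x by exact: integral_ge0.
have : 0 <= \int[joint_law PX K]_z f^\+ z by exact: integral_ge0.
have : 0 <= \int[joint_law PX K]_z f^\- z by exact: integral_ge0.
move: defpsi; rewrite -/f.
move: (\int[PX]_x h^\+ x) (\int[PX]_x h^\- x).
move: (\int[_]_z f^\+ z) (\int[_]_z f^\- z).
move=> [c| |] [e| |] [a| |] [b| |]//=; last by case.
- by move=> _ _ _ _ _ _ _; rewrite -!EFinD !lee_fin; lra.
all: by move=> *; rewrite ?leey.
Qed.

End entropy.

(** * Risk and entropy gaps *)

Lemma bayes_gap_le (R : realType) (a b c d : \bar R) (B : R) :
  a \is a fin_num -> b \is a fin_num -> c \is a fin_num -> d \is a fin_num ->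
  a - b <= B%:E -> c - d <= B%:E -> b <= c -> d <= a ->
  `|b - d| <= B%:E /\ a - d <= (2 * B)%:E.
Proof.
move: a b c d => [a| |] [b| |] [c| |] [d| |]// _ _ _ _.
rewrite -!EFinB abse_EFin !lee_fin ler_norml => *.
(* The entropies are [b] and [d]; the two sides of the absolute value come from [b - d <= c - d] and
   [d - b <= a - b]. *)
by split; [apply/andP; split|]; lra.
Qed.

Theorem theorem15 (R : realType) (dX dY : measure_display)
    (X : measurableType dX) (Y : measurableType dY) (A : Type)
    (ell : Y -> A -> R)
    (PX QX : probability X R) (PYX QYX : R.-pker X ~> Y)
    (psiP psiQ : X -> A)
    (bayesP : is_bayes_rule ell PX PYX psiP)
    (bayesQ : is_bayes_rule ell QX QYX psiQ)
    (finPQ : expectation_finite (joint_law PX PYX) (rule_loss ell psiQ)) :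
  (forall (BQ : R)
     (finQP : expectation_finite (joint_law QX QYX) (rule_loss ell psiP))
     (hQ1 : 'E_(joint_law PX PYX)[rule_loss ell psiQ]
            - 'E_(joint_law QX QYX)[rule_loss ell psiQ] <= BQ%:E)
     (hQ2 : 'E_(joint_law QX QYX)[rule_loss ell psiP]
            - 'E_(joint_law PX PYX)[rule_loss ell psiP] <= BQ%:E),
     `| gen_cond_entropy ell QYX QX - gen_cond_entropy ell PYX PX | <= BQ%:E /\
     'E_(joint_law PX PYX)[rule_loss ell psiQ] - gen_cond_entropy ell PYX PX
       <= (2 * BQ)%:E)
  /\
  (forall (BP : R)
     (finPxQ : forall x, expectation_finite (cond_law PYX x) (ell^~ (psiQ x)))
     (finQxP : forall x, expectation_finite (cond_law QYX x) (ell^~ (psiP x)))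
     (intQ : PX.-integrable [set: X] (fun x =>
        'E_(cond_law PYX x)[ell^~ (psiQ x)]
        - 'E_(cond_law QYX x)[ell^~ (psiQ x)]))
     (intP : PX.-integrable [set: X] (fun x =>
        'E_(cond_law QYX x)[ell^~ (psiP x)]
        - 'E_(cond_law PYX x)[ell^~ (psiP x)]))
     (hP1 : \int[PX]_x ('E_(cond_law PYX x)[ell^~ (psiQ x)]
                        - 'E_(cond_law QYX x)[ell^~ (psiQ x)]) <= BP%:E)
     (hP2 : \int[PX]_x ('E_(cond_law QYX x)[ell^~ (psiP x)]
                        - 'E_(cond_law PYX x)[ell^~ (psiP x)]) <= BP%:E),
     (expectation_finite (joint_law PX QYX) (rule_loss ell psiQ) ->
      `| gen_cond_entropy ell QYX PX - gen_cond_entropy ell PYX PX | <= BP%:E) /\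
     'E_(joint_law PX PYX)[rule_loss ell psiQ] - gen_cond_entropy ell PYX PX
       <= (2 * BP)%:E).
Proof.
have [intP HP finP entP] := bayesP; have [intQ HQ finQ entQ] := bayesQ.
have HP_le : 'E_(joint_law PX PYX)[rule_loss ell psiP]
    <= 'E_(joint_law PX PYX)[rule_loss ell psiQ].
  by rewrite -HP; exact: gen_cond_entropy_le.
split=> [BQ finQP hQ1 hQ2|BP finPxQ finQxP intfh intkg hP1 hP2].
  rewrite HP HQ; apply: bayes_gap_le hQ1 hQ2 _ HP_le;
    try exact: expectation_finite_fin_num.
  by rewrite -HQ; exact: gen_cond_entropy_le.
pose f x := 'E_(cond_law PYX x)[ell^~ (psiQ x)].
pose g x := 'E_(cond_law PYX x)[ell^~ (psiP x)].
pose h x := 'E_(cond_law QYX x)[ell^~ (psiQ x)].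
pose k x := 'E_(cond_law QYX x)[ell^~ (psiP x)].
have intf : PX.-integrable [set: X] f.
  exact: integrable_expectation_rule_loss.
have intg : PX.-integrable [set: X] g.
  exact: integrable_expectation_rule_loss.
(* Integrability under [QYX] averaged along [PX] is recovered from the assumed integrable
   differences: [h] is [f] minus [f - h], and [k] is [k - g] plus [g], where [f] and [g] are finite
   at every [x]. *)
have inth : PX.-integrable [set: X] h.
  have -> : h = f \- (fun x => f x - h x).
    apply/funext => x.
    have ffin : f x \is a fin_num by exact: expectation_finite_fin_num.
    by rewrite oppeB ?fin_num_adde_defr// addeA subee// add0e.
  exact: integrableB.
have intk : PX.-integrable [set: X] k.
  have -> : k = (fun x => k x - g x) \+ g.
    apply/funext => x; rewrite subeK//; exact: expectation_finite_fin_num.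
  exact: integrableD.
have hk : \int[PX]_x h x <= \int[PX]_x k x.
  by apply: le_integral => // x _; rewrite /h -entQ; exact: gen_entropy_le.
move: hP1 hP2; rewrite (integralB measurableT intf inth).
rewrite (integralB measurableT intk intg).
rewrite HP !expectation_rule_loss// in HP_le *.
move=> hP1 hP2.
have [] := bayes_gap_le (integrable_fin_num measurableT intf)
  (integrable_fin_num measurableT inth) (integrable_fin_num measurableT intk)
  (integrable_fin_num measurableT intg) hP1 hP2 hk HP_le.
move=> ent_gap risk_gap; split=> // finPxQQ.
(* [ent_gap] is the required bound with this integral in place of the entropy. The finite risk of
   [psiQ] gives one inequality, and [h] being the fibrewise entropy gives the other. *)
suff -> : gen_cond_entropy ell QYX PX = \int[PX]_x h x by [].
apply/eqP; rewrite eq_le; apply/andP; split.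
  by rewrite -expectation_rule_loss//; exact: gen_cond_entropy_le.
by apply: le_gen_cond_entropy => // x; rewrite /h entQ.
Qed.
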